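(* Let $H\in C^\infty(\mathbb{R}^2)$ and let $\chi(q,p,t)$ be a smooth, rapidly decaying complex-valued solution of the Koopman–van Hove equation $$i\hbar\,\partial_t\chi=i\hbar\{H,\chi\}-\big(p\,\partial_pH-H\big)\chi .$$ Define $$\rho_c:=|\chi|^2+\partial_p\big(p|\chi|^2\big)+\hbar\,\operatorname{Im}\{\bar\chi,\chi\}.$$ Then $\rho_c$ is real and satisfies the classical Liouville equation $\partial_t\rho_c=\{H,\rho_c\}$. Furthermore, $\int\rho_c\,H\,{\rm d}q\,{\rm d}p=\operatorname{Re}\int\bar\chi\big(i\hbar\{H,\chi\}-(p\,\partial_pH-H)\chi\big)\,{\rm d}q\,{\rm d}p$.
   Context: Phase space is $\mathbb{R}^2$ with coordinates $(q,p)$ and Poisson bracket $\{f,g\}=\partial_qf\,\partial_pg-\partial_pf\,\partial_qg$; $\bar\chi$ denotes complex conjugation and $\hbar>0$ is a constant. *)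

(* Defs.v *)
From Stdlib Require Import Reals List.
From Coquelicot Require Import Coquelicot.
Open Scope R_scope.

Inductive dir3 := Dq | Dp | Dt.

Definition pd3 (d : dir3) (f : R -> R -> R -> R) : R -> R -> R -> R :=
  match d with
  | Dq => fun q p t => Derive (fun x => f x p t) q
  | Dp => fun q p t => Derive (fun x => f q x t) p
  | Dt => fun q p t => Derive (fun x => f q p x) t
  end.

Definition ex_pd3 (d : dir3) (f : R -> R -> R -> R) (q p t : R) : Prop :=
  match d with
  | Dq => ex_derive (fun x => f x p t) q
  | Dp => ex_derive (fun x => f q x t) p
  | Dt => ex_derive (fun x => f q p x) t
  end.

Fixpoint pd3s (ds : list dir3) (f : R -> R -> R -> R) : R -> R -> R -> R :=
  match ds with
  | nil => f
  | d :: ds' => pd3 d (pd3s ds' f)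
  end.

Definition smooth3 (f : R -> R -> R -> R) : Prop :=
  forall ds : list dir3,
    (forall q p t,
       continuous (fun x : R * R * R => pd3s ds f (fst (fst x)) (snd (fst x)) (snd x))
                  (q, p, t)) /\
    (forall d q p t, ex_pd3 d (pd3s ds f) q p t).

Definition liftH (H : R -> R -> R) : R -> R -> R -> R := fun q p _ => H q p.

Definition smooth2 (H : R -> R -> R) : Prop := smooth3 (liftH H).

Definition reF (f : R -> R -> R -> C) : R -> R -> R -> R := fun q p t => Re (f q p t).
Definition imF (f : R -> R -> R -> C) : R -> R -> R -> R := fun q p t => Im (f q p t).

Definition dC (d : dir3) (f : R -> R -> R -> C) : R -> R -> R -> C :=
  fun q p t => (pd3 d (reF f) q p t, pd3 d (imF f) q p t).

Definition conjF (f : R -> R -> R -> C) : R -> R -> R -> C := fun q p t => Cconj (f q p t).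

Definition PB (f g : R -> R -> R -> C) : R -> R -> R -> C :=
  fun q p t => (dC Dq f q p t * dC Dp g q p t - dC Dp f q p t * dC Dq g q p t)%C.

Definition Hc (H : R -> R -> R) : R -> R -> R -> C := fun q p _ => RtoC (H q p).

Definition KvH (hbar : R) (H : R -> R -> R) (chi : R -> R -> R -> C) : Prop :=
  forall q p t,
    (Ci * RtoC hbar * dC Dt chi q p t)%C =
    (Ci * RtoC hbar * PB (Hc H) chi q p t
     - RtoC (p * pd3 Dp (liftH H) q p t - H q p) * chi q p t)%C.

(* "rapidly decaying" (in (q,p), for each time t): every derivative of chi
   decays faster than any power of (1+q^2+p^2), also after multiplication by
   any derivative of H (so that all the phase-space integrals involving H
   converge and integrations by parts have no boundary terms). *)
Definition rapid_decay (H : R -> R -> R) (chi : R -> R -> R -> C) : Prop :=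
  forall (t : R) (ds dsH : list dir3) (n : nat),
    exists M : R, forall q p,
      (1 + q ^ 2 + p ^ 2) ^ n * (1 + Rabs (pd3s dsH (liftH H) q p t)) *
        (Rabs (pd3s ds (reF chi) q p t) + Rabs (pd3s ds (imF chi) q p t)) <= M.

Definition rho_c (hbar : R) (chi : R -> R -> R -> C) : R -> R -> R -> C :=
  fun q p t =>
    (RtoC (Cmod (chi q p t) ^ 2)
     + dC Dp (fun q' p' t' => RtoC (p' * Cmod (chi q' p' t') ^ 2)) q p t
     + RtoC (hbar * Im (PB (conjF chi) chi q p t)))%C.

Definition Int2 (f : R -> R -> R) : R :=
  RInt_gen (fun q => RInt_gen (fun p => f q p) (Rbar_locally m_infty) (Rbar_locally p_infty))
           (Rbar_locally m_infty) (Rbar_locally p_infty).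

(* Main.v *)
Require Import Defs.
From Stdlib Require Import Reals List Lra FunctionalExtensionality.
From Coquelicot Require Import Coquelicot.
Import ListNotations.
Open Scope R_scope.

(* Write chi = a + i b.  The Koopman-van Hove equation becomes the real system
     hbar a_t = hbar {H, a} - L b,   hbar b_t = hbar {H, b} + L a,   L = p H_p - H,
   and rho_c = 2 (a^2 + b^2) + 2 p (a a_p + b b_p) + 2 hbar {a, b} is real.
   Differentiating rho_c in time, substituting the system and using the symmetry
   of second derivatives, the terms containing L cancel and {H, rho_c} remains.
   For the energy, rho_c H equals Re (conj chi (i hbar {H, chi} - L chi)) plus a
   divergence d_p F + d_q G, with F, G polynomial in H, a, b and their first
   derivatives.  Rapid decay of chi against derivatives of H makes every term
   O(1 / ((1 + q^2) (1 + p^2))), so the divergence integrates to zero. *)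

(** * Partial derivatives of smooth functions *)

(* Keeps [auto_derive] from unfolding partial derivatives, so that its results
   and side conditions stay expressed through [pd3]. *)
Local Arguments pd3 : simpl never.

Definition pb3 (f g : R -> R -> R -> R) (q p t : R) : R :=
  pd3 Dq f q p t * pd3 Dp g q p t - pd3 Dp f q p t * pd3 Dq g q p t.

Definition lagrangian (H : R -> R -> R) (q p t : R) : R :=
  p * pd3 Dp (liftH H) q p t - liftH H q p t.

Definition mul3 (h f g : R -> R -> R -> R) (q p t : R) : R := h q p t * f q p t * g q p t.

Lemma pd3s_app ds1 ds2 f : pd3s (ds1 ++ ds2) f = pd3s ds1 (pd3s ds2 f).
Proof. induction ds1 as [|d ds1 IH]; simpl; [reflexivity | now rewrite IH]. Qed.

Lemma smooth3_pd3s f ds : smooth3 f -> smooth3 (pd3s ds f).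
Proof. intros Hf ds'. rewrite <- pd3s_app. apply Hf. Qed.

Lemma smooth3_pd3 f d : smooth3 f -> smooth3 (pd3 d f).
Proof. apply (smooth3_pd3s f [d]). Qed.

Lemma ex_derive_Dq f q p t : smooth3 f -> ex_derive (fun x => f x p t) q.
Proof. intros Hf. exact (proj2 (Hf nil) Dq q p t). Qed.

Lemma ex_derive_Dp f q p t : smooth3 f -> ex_derive (fun x => f q x t) p.
Proof. intros Hf. exact (proj2 (Hf nil) Dp q p t). Qed.

Lemma ex_derive_Dt f q p t : smooth3 f -> ex_derive (fun x => f q p x) t.
Proof. intros Hf. exact (proj2 (Hf nil) Dt q p t). Qed.

Ltac smooth3_pd3_tac :=
  lazymatch goal with
  | |- smooth3 (pd3 ?d ?f) => apply (smooth3_pd3 f d); smooth3_pd3_tac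
  | |- _ => assumption
  end.

Ltac solve_ex_derive :=
  repeat match goal with
  | |- _ /\ _ => split
  | |- True => exact I
  | |- ex_derive (fun x => ?f x ?p ?t) ?q => apply (ex_derive_Dq f q p t); smooth3_pd3_tac
  | |- ex_derive (fun x => ?f ?q x ?t) ?p => apply (ex_derive_Dp f q p t); smooth3_pd3_tac
  | |- ex_derive (fun x => ?f ?q ?p x) ?t => apply (ex_derive_Dt f q p t); smooth3_pd3_tac
  end.

Ltac fold_pd3 :=
  repeat match goal with
  | |- context [Derive (fun x => ?f x ?p ?t) ?q] => change (Derive (fun x => f x p t) q) with (pd3 Dq f q p t)
  | |- context [Derive (fun x => ?f ?q x ?t) ?p] => change (Derive (fun x => f q x t) p) with (pd3 Dp f q p t)
  | |- context [Derive (fun x => ?f ?q ?p x) ?t] => change (Derive (fun x => f q p x) t) with (pd3 Dt f q p t)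
  end.

Lemma pd3_Dq_is_derive f q p t l : is_derive (fun x => f x p t) q l -> pd3 Dq f q p t = l.
Proof. apply is_derive_unique. Qed.

Lemma pd3_Dp_is_derive f q p t l : is_derive (fun x => f q x t) p l -> pd3 Dp f q p t = l.
Proof. apply is_derive_unique. Qed.

Lemma pd3_Dt_is_derive f q p t l : is_derive (fun x => f q p x) t l -> pd3 Dt f q p t = l.
Proof. apply is_derive_unique. Qed.

Ltac head_constant t := lazymatch t with ?f _ => head_constant f | _ => t end.

(* Rewrites every [pd3 d F q p t] by its value computed with [auto_derive], for a
   function [F] given by an explicit formula in smooth functions. *)
Ltac pd3_eval F :=
  let c := head_constant F in
  let by_auto_derive := unfold c, pb3, lagrangian, mul3; auto_derive; [solve_ex_derive | fold_pd3; reflexivity] in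
  repeat match goal with
  | |- context [pd3 ?d F ?q ?p ?t] =>
    let E := fresh "E" in
    eassert (E : pd3 d F q p t = _)
      by (first [ apply pd3_Dq_is_derive | apply pd3_Dp_is_derive | apply pd3_Dt_is_derive ];
          by_auto_derive);
    rewrite E; clear E
  end.

Lemma continuous_pair {U V : UniformSpace} (z : U * V) :
  continuous (fun x : U * V => (fst x, snd x)) z.
Proof. apply (continuous_ext (fun x => x)); [now intros [] | apply continuous_id]. Qed.

Lemma continuity_2d_pt_slices (F : R -> R -> R -> R) q p t :
  (forall q p t, continuous (fun x : R * R * R => F (fst (fst x)) (snd (fst x)) (snd x)) (q, p, t)) ->
  continuity_2d_pt (fun u v => F u v t) q p /\
  continuity_2d_pt (fun u v => F u p v) q t /\
  continuity_2d_pt (fun u v => F q u v) p t.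
Proof.
  intros HF. set (G := fun x : R * R * R => F (fst (fst x)) (snd (fst x)) (snd x)).
  repeat split; apply continuity_2d_pt_filterlim.
  - apply (continuous_comp (fun z : R * R => (z, t)) G (q, p)); [|apply HF].
    apply continuous_comp_2; [apply continuous_id | apply continuous_const | apply continuous_pair].
  - apply (continuous_comp (fun z : R * R => ((fst z, p), snd z)) G (q, t)); [|apply HF].
    apply continuous_comp_2; [|apply continuous_snd | apply continuous_pair].
    apply continuous_comp_2; [apply continuous_fst | apply continuous_const | apply continuous_pair].
  - apply (continuous_comp (fun z : R * R => ((q, fst z), snd z)) G (p, t)); [|apply HF].
    apply continuous_comp_2; [|apply continuous_snd | apply continuous_pair].
    apply continuous_comp_2; [apply continuous_const | apply continuous_fst | apply continuous_pair].
Qed.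

Lemma continuity_2d_pt_smooth3 f q p t : smooth3 f ->
  continuity_2d_pt (fun u v => f u v t) q p /\
  continuity_2d_pt (fun u v => f u p v) q t /\
  continuity_2d_pt (fun u v => f q u v) p t.
Proof. intros Hf. apply continuity_2d_pt_slices, (Hf nil). Qed.

Section Schwarz.
Variable g : R -> R -> R -> R.
Hypothesis g_smooth : smooth3 g.

Let g_smooth_d d : smooth3 (pd3 d g) := smooth3_pd3 g d g_smooth.
Let g_smooth_dd d1 d2 : smooth3 (pd3 d1 (pd3 d2 g)) := smooth3_pd3 _ d1 (g_smooth_d d2).

Lemma pd3_comm_qp q p t : pd3 Dq (pd3 Dp g) q p t = pd3 Dp (pd3 Dq g) q p t.
Proof.
  apply (Schwarz (fun u v => g u v t)).
  - exists (mkposreal 1 Rlt_0_1). intros u v _ _. repeat split.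
    + apply ex_derive_Dq, g_smooth.
    + apply ex_derive_Dp, g_smooth.
    + apply (ex_derive_Dq (pd3 Dp g)), g_smooth_d.
    + apply (ex_derive_Dp (pd3 Dq g)), g_smooth_d.
  - exact (proj1 (continuity_2d_pt_smooth3 _ q p t (g_smooth_dd Dq Dp))).
  - exact (proj1 (continuity_2d_pt_smooth3 _ q p t (g_smooth_dd Dp Dq))).
Qed.

Lemma pd3_comm_qt q p t : pd3 Dq (pd3 Dt g) q p t = pd3 Dt (pd3 Dq g) q p t.
Proof.
  apply (Schwarz (fun u v => g u p v)).
  - exists (mkposreal 1 Rlt_0_1). intros u v _ _. repeat split.
    + apply ex_derive_Dq, g_smooth.
    + apply ex_derive_Dt, g_smooth.
    + apply (ex_derive_Dq (pd3 Dt g)), g_smooth_d.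
    + apply (ex_derive_Dt (pd3 Dq g)), g_smooth_d.
  - exact (proj1 (proj2 (continuity_2d_pt_smooth3 _ q p t (g_smooth_dd Dq Dt)))).
  - exact (proj1 (proj2 (continuity_2d_pt_smooth3 _ q p t (g_smooth_dd Dt Dq)))).
Qed.

Lemma pd3_comm_pt q p t : pd3 Dp (pd3 Dt g) q p t = pd3 Dt (pd3 Dp g) q p t.
Proof.
  apply (Schwarz (fun u v => g q u v)).
  - exists (mkposreal 1 Rlt_0_1). intros u v _ _. repeat split.
    + apply ex_derive_Dp, g_smooth.
    + apply ex_derive_Dt, g_smooth.
    + apply (ex_derive_Dp (pd3 Dt g)), g_smooth_d.
    + apply (ex_derive_Dt (pd3 Dp g)), g_smooth_d.
  - exact (proj2 (proj2 (continuity_2d_pt_smooth3 _ q p t (g_smooth_dd Dp Dt)))).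
  - exact (proj2 (proj2 (continuity_2d_pt_smooth3 _ q p t (g_smooth_dd Dt Dp)))).
Qed.

Lemma pd3_comm d1 d2 q p t : pd3 d1 (pd3 d2 g) q p t = pd3 d2 (pd3 d1 g) q p t.
Proof.
  destruct d1, d2; try reflexivity.
  - apply pd3_comm_qp.
  - apply pd3_comm_qt.
  - symmetry; apply pd3_comm_qp.
  - apply pd3_comm_pt.
  - symmetry; apply pd3_comm_qt.
  - symmetry; apply pd3_comm_pt.
Qed.

End Schwarz.

(** * Reality of rho_c and the Liouville equation *)

Lemma pd3_zero d q p t : pd3 d (fun _ _ _ => 0) q p t = 0.
Proof. destruct d; unfold pd3; apply Derive_const. Qed.

Definition kvh_rhs (hbar : R) (H : R -> R -> R) (chi : R -> R -> R -> C) (q p t : R) : C :=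
  (Ci * RtoC hbar * PB (Hc H) chi q p t
   - RtoC (p * pd3 Dp (liftH H) q p t - H q p) * chi q p t)%C.

Lemma KvH_components hbar H chi q p t : KvH hbar H chi ->
  hbar * pd3 Dt (reF chi) q p t =
    hbar * pb3 (liftH H) (reF chi) q p t - lagrangian H q p t * imF chi q p t /\
  hbar * pd3 Dt (imF chi) q p t =
    hbar * pb3 (liftH H) (imF chi) q p t + lagrangian H q p t * reF chi q p t.
Proof.
  intros K. specialize (K q p t). unfold PB, dC in K. rewrite !pd3_zero in K.
  apply (f_equal (fun z => (fst z, snd z))) in K. injection K. clear K.
  unfold pb3, lagrangian, reF, imF, liftH, Re, Im in *. cbn in *. intros Kim Kre. split; nra.
Qed.

(* [Re rho_c] for [chi = a + i b]: [|chi|^2 + d_p (p |chi|^2) + hbar Im {conj chi, chi}]. *)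
Definition rho_re (hbar : R) (a b : R -> R -> R -> R) (q p t : R) : R :=
  2 * (a q p t ^ 2 + b q p t ^ 2)
  + 2 * p * (a q p t * pd3 Dp a q p t + b q p t * pd3 Dp b q p t)
  + 2 * hbar * pb3 a b q p t.

Section RealKvH.
Variables (hbar : R) (H : R -> R -> R) (a b : R -> R -> R -> R).
Hypothesis hbar_pos : 0 < hbar.
Hypothesis H_smooth : smooth2 H.
Hypothesis a_smooth : smooth3 a.
Hypothesis b_smooth : smooth3 b.
Hypothesis a_flow : forall q p t,
  hbar * pd3 Dt a q p t = hbar * pb3 (liftH H) a q p t - lagrangian H q p t * b q p t.
Hypothesis b_flow : forall q p t,
  hbar * pd3 Dt b q p t = hbar * pb3 (liftH H) b q p t + lagrangian H q p t * a q p t.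

Definition kvh_dt_a (q p t : R) : R :=
  pb3 (liftH H) a q p t - lagrangian H q p t / hbar * b q p t.
Definition kvh_dt_b (q p t : R) : R :=
  pb3 (liftH H) b q p t + lagrangian H q p t / hbar * a q p t.

Lemma pd3_Dt_a : pd3 Dt a = kvh_dt_a.
Proof.
  do 3 (apply functional_extensionality; intro). unfold kvh_dt_a.
  apply (Rmult_eq_reg_l hbar); [rewrite a_flow; field|]; lra.
Qed.

Lemma pd3_Dt_b : pd3 Dt b = kvh_dt_b.
Proof.
  do 3 (apply functional_extensionality; intro). unfold kvh_dt_b.
  apply (Rmult_eq_reg_l hbar); [rewrite b_flow; field|]; lra.
Qed.

Lemma pd3_Dt_pd3_a d q p t : pd3 Dt (pd3 d a) q p t = pd3 d kvh_dt_a q p t.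
Proof. rewrite pd3_comm by assumption. now rewrite pd3_Dt_a. Qed.

Lemma pd3_Dt_pd3_b d q p t : pd3 Dt (pd3 d b) q p t = pd3 d kvh_dt_b q p t.
Proof. rewrite pd3_comm by assumption. now rewrite pd3_Dt_b. Qed.

Lemma rho_re_liouville q p t :
  pd3 Dt (rho_re hbar a b) q p t = pb3 (liftH H) (rho_re hbar a b) q p t.
Proof.
  unfold pb3 at 1. pd3_eval (rho_re hbar a b).
  rewrite !pd3_Dt_pd3_a, !pd3_Dt_pd3_b, pd3_Dt_a, pd3_Dt_b.
  pd3_eval kvh_dt_a. pd3_eval kvh_dt_b.
  rewrite !(pd3_comm a a_smooth Dp Dq), !(pd3_comm b b_smooth Dp Dq),
    !(pd3_comm (liftH H) H_smooth Dp Dq).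
  unfold kvh_dt_a, kvh_dt_b, pb3, lagrangian. field. lra.
Qed.

End RealKvH.

Lemma pd3_imF_conjF chi d q p t : pd3 d (imF (conjF chi)) q p t = - pd3 d (imF chi) q p t.
Proof. destruct d; unfold pd3; apply Derive_opp. Qed.

Lemma Im_rho_c hbar chi q p t : Im (rho_c hbar chi q p t) = 0.
Proof. unfold rho_c, dC, imF, pd3. simpl. rewrite Derive_const. ring. Qed.

Lemma Re_rho_c hbar chi q p t : smooth3 (reF chi) -> smooth3 (imF chi) ->
  Re (rho_c hbar chi q p t) = rho_re hbar (reF chi) (imF chi) q p t.
Proof.
  intros Ha Hb.
  assert (Emod : reF (fun q' p' t' => RtoC (p' * Cmod (chi q' p' t') ^ 2)) =
                 fun q' p' t' => p' * (reF chi q' p' t' ^ 2 + imF chi q' p' t' ^ 2)).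
  { do 3 (apply functional_extensionality; intro). unfold reF, imF. now rewrite <- Cmod2_alt. }
  change (Re (rho_c hbar chi q p t)) with
    (Cmod (chi q p t) ^ 2
     + pd3 Dp (reF (fun q' p' t' => RtoC (p' * Cmod (chi q' p' t') ^ 2))) q p t
     + hbar * Im (PB (conjF chi) chi q p t)).
  rewrite Emod.
  erewrite pd3_Dp_is_derive by (auto_derive; [solve_ex_derive | fold_pd3; reflexivity]).
  rewrite Cmod2_alt. unfold PB, dC. rewrite !pd3_imF_conjF.
  change (reF (conjF chi)) with (reF chi).
  change (Re (chi q p t)) with (reF chi q p t). change (Im (chi q p t)) with (imF chi q p t).
  unfold rho_re, pb3. simpl. ring.
Qed.

Lemma rho_c_liouville hbar H chi q p t :
  0 < hbar -> smooth2 H -> smooth3 (reF chi) -> smooth3 (imF chi) -> KvH hbar H chi ->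
  dC Dt (rho_c hbar chi) q p t = PB (Hc H) (rho_c hbar chi) q p t.
Proof.
  intros Hpos HH Ha Hb K.
  assert (Ere : reF (rho_c hbar chi) = rho_re hbar (reF chi) (imF chi)).
  { do 3 (apply functional_extensionality; intro). now apply Re_rho_c. }
  assert (Eim : imF (rho_c hbar chi) = fun _ _ _ => 0).
  { do 3 (apply functional_extensionality; intro). apply Im_rho_c. }
  unfold PB, dC. rewrite Ere, Eim, !pd3_zero.
  change (reF (Hc H)) with (liftH H).
  rewrite (rho_re_liouville hbar H (reF chi) (imF chi)); auto.
  - unfold pb3. apply injective_projections; simpl; ring.
  - intros; apply KvH_components, K.
  - intros; apply KvH_components, K.
Qed.

(** * Improper integrals over the line and the phase plane *)

Notation is_RInt_line f l := (is_RInt_gen f (Rbar_locally m_infty) (Rbar_locally p_infty) l).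
Notation RInt_line f := (RInt_gen f (Rbar_locally m_infty) (Rbar_locally p_infty)).

Lemma ball_R_iff (x y e : R) : ball x e y <-> Rabs (y - x) < e.
Proof. reflexivity. Qed.

(* Coquelicot's generic integration lemmas at [R]: unification does not infer the
   normed-module structure of [R] for them. *)
Lemma RInt_correct_R (f : R -> R) a b : ex_RInt f a b -> is_RInt f a b (RInt f a b).
Proof. exact (@RInt_correct R_CompleteNormedModule f a b). Qed.

Lemma ex_RInt_continuous_R (f : R -> R) a b : (forall x, continuous f x) -> ex_RInt f a b.
Proof. intros Hf. apply (@ex_RInt_continuous R_CompleteNormedModule). intros; apply Hf. Qed.

Lemma RInt_swap_R (f : R -> R) a b : ex_RInt f a b -> RInt f b a = - RInt f a b.
Proof. intros Hf. now rewrite <- (@opp_RInt_swap R_CompleteNormedModule f a b Hf). Qed.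

Lemma RInt_Chasles_R (f : R -> R) a b c : ex_RInt f a b -> ex_RInt f b c ->
  RInt f a b + RInt f b c = RInt f a c.
Proof. exact (@RInt_Chasles R_CompleteNormedModule f a b c). Qed.

Lemma RInt_minus_R (f g : R -> R) a b : ex_RInt f a b -> ex_RInt g a b ->
  RInt (fun x => f x - g x) a b = RInt f a b - RInt g a b.
Proof. exact (@RInt_minus R_CompleteNormedModule f g a b). Qed.

Lemma RInt_line_unique (f : R -> R) l : is_RInt_line f l -> RInt_line f = l.
Proof. exact (@is_RInt_gen_unique R_CompleteNormedModule _ _ _ _ f l). Qed.

Lemma is_RInt_line_plus (f g : R -> R) lf lg :
  is_RInt_line f lf -> is_RInt_line g lg -> is_RInt_line (fun x => f x + g x) (lf + lg).
Proof. exact (@is_RInt_gen_plus R_NormedModule _ _ _ _ f g lf lg). Qed.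

Lemma is_RInt_inv_sq a b : (0 < a \/ b < 0) -> a <= b -> is_RInt (fun x => / x ^ 2) a b (/ a - / b).
Proof.
  intros Hab Hle.
  assert (Hnz : forall x, Rmin a b <= x <= Rmax a b -> x <> 0).
  { rewrite Rmin_left, Rmax_right by lra. intros x Hx. lra. }
  replace (/ a - / b) with (minus ((fun x => - / x) b) ((fun x => - / x) a))
    by (unfold minus, plus, opp; simpl; ring).
  apply (is_RInt_derive (fun x => - / x)).
  - intros x Hx. specialize (Hnz x Hx). auto_derive; [exact Hnz | field; exact Hnz].
  - intros x Hx. specialize (Hnz x Hx). apply (@ex_derive_continuous R_AbsRing R_NormedModule).
    auto_derive. rewrite Rmult_1_r. now apply Rmult_integral_contrapositive.
Qed.

Lemma filterlim_Rabs_le {T} (F : (T -> Prop) -> Prop) {FF : ProperFilter F} (f : T -> R) y c B :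
  filterlim f F (locally y) -> F (fun x => Rabs (f x - c) <= B) -> Rabs (y - c) <= B.
Proof.
  intros Hf HB. destruct (Rle_or_lt (Rabs (y - c)) B) as [Hle|Hlt]; auto. exfalso.
  assert (He : 0 < Rabs (y - c) - B) by lra.
  assert (Hball : F (fun x => ball y (mkposreal _ He) (f x))) by (apply Hf, locally_ball).
  destruct (filter_ex _ (filter_and _ _ Hball HB)) as [x [Hx1 Hx2]].
  apply ball_R_iff in Hx1. change (Rabs (f x - y) < Rabs (y - c) - B) in Hx1.
  assert (Rabs (y - c) <= Rabs (f x - y) + Rabs (f x - c)).
  { replace (y - c) with (- (f x - y) + (f x - c)) by ring.
    eapply Rle_trans; [apply Rabs_triang | rewrite Rabs_Ropp; lra]. }
  lra.
Qed.

Lemma eq0_of_le_inv x D : (forall N, 1 <= N -> Rabs x <= D / N) -> x = 0.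
Proof.
  intros Hx. destruct (Req_dec x 0) as [E|E]; auto. exfalso.
  assert (Hpos : 0 < Rabs x) by (apply Rabs_pos_lt; auto).
  assert (HD : 0 <= D).
  { specialize (Hx 1 (Rle_refl 1)). unfold Rdiv in Hx. rewrite Rinv_1 in Hx.
    pose proof (Rabs_pos x). lra. }
  set (N := 1 + 2 * D / Rabs x).
  assert (HN : 1 <= N) by (unfold N; assert (0 <= 2 * D / Rabs x) by (apply Rdiv_le_0_compat; lra); lra).
  specialize (Hx N HN).
  assert (Rabs x * N = Rabs x + 2 * D) by (unfold N; field; lra).
  apply (Rmult_le_compat_r N) in Hx; [|lra].
  replace (D / N * N) with D in Hx by (field; lra). lra.
Qed.

Section QuadraticDecay.
Variables (h : R -> R) (C : R).
Hypothesis h_cont : forall x, continuous h x.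
Hypothesis C_nonneg : 0 <= C.
Hypothesis h_bound : forall x, Rabs (h x) <= C / (1 + x ^ 2).

Let h_ex a b : ex_RInt h a b := ex_RInt_continuous_R h a b h_cont.

Lemma RInt_decay_le a b : (0 < a \/ b < 0) -> a <= b -> Rabs (RInt h a b) <= C * (/ a - / b).
Proof.
  intros Hab Hle.
  apply (norm_RInt_le h (fun x => C * / x ^ 2) a b); auto.
  - intros x Hx. assert (x <> 0) by lra.
    change (norm (h x)) with (Rabs (h x)).
    eapply Rle_trans; [apply h_bound|]. unfold Rdiv. apply Rmult_le_compat_l; auto.
    assert (0 < x ^ 2) by (simpl; nra). apply Rinv_le_contravar; lra.
  - apply RInt_correct_R, h_ex.
  - apply (is_RInt_scal (fun x => / x ^ 2) a b C). now apply is_RInt_inv_sq.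
Qed.

Lemma RInt_tail_pos N a b : 1 <= N -> N <= a -> N <= b -> Rabs (RInt h a b) <= C / N.
Proof.
  intros HN Ha Hb. unfold Rdiv.
  destruct (Rle_or_lt a b) as [Hab|Hab].
  - eapply Rle_trans; [apply RInt_decay_le; lra|]. apply Rmult_le_compat_l; auto.
    assert (/ a <= / N) by (apply Rinv_le_contravar; lra).
    assert (0 < / b) by (apply Rinv_0_lt_compat; lra). lra.
  - rewrite RInt_swap_R, Rabs_Ropp by apply h_ex.
    eapply Rle_trans; [apply RInt_decay_le; lra|]. apply Rmult_le_compat_l; auto.
    assert (/ b <= / N) by (apply Rinv_le_contravar; lra).
    assert (0 < / a) by (apply Rinv_0_lt_compat; lra). lra.
Qed.

Lemma RInt_tail_neg N a b : 1 <= N -> a <= - N -> b <= - N -> Rabs (RInt h a b) <= C / N.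
Proof.
  intros HN Ha Hb.
  assert (K : forall u v, u <= v -> v <= - N -> C * (/ u - / v) <= C / N).
  { intros u v Huv Hv. unfold Rdiv. apply Rmult_le_compat_l; auto.
    assert (/ u < 0) by (apply Rinv_lt_0_compat; lra).
    assert (Hinv : / - v <= / N) by (apply Rinv_le_contravar; lra).
    rewrite Rinv_opp in Hinv. lra. }
  destruct (Rle_or_lt a b) as [Hab|Hab].
  - eapply Rle_trans; [apply RInt_decay_le; lra | apply K; lra].
  - rewrite RInt_swap_R, Rabs_Ropp by apply h_ex.
    eapply Rle_trans; [apply RInt_decay_le; lra | apply K; lra].
Qed.

Lemma RInt_window_close N a b : 1 <= N -> a <= - N -> N <= b ->
  Rabs (RInt h a b - RInt h (- N) N) <= 2 * C / N.
Proof.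
  intros HN Ha Hb.
  rewrite <- (RInt_Chasles_R h a (- N) b), <- (RInt_Chasles_R h (- N) N b) by apply h_ex.
  pose proof (RInt_tail_neg N a (- N) HN Ha (Rle_refl _)).
  pose proof (RInt_tail_pos N N b HN (Rle_refl _) Hb).
  replace (RInt h a (- N) + (RInt h (- N) N + RInt h N b) - RInt h (- N) N)
    with (RInt h a (- N) + RInt h N b) by ring.
  eapply Rle_trans; [apply Rabs_triang|]. unfold Rdiv in *. lra.
Qed.

Lemma is_RInt_line_decay : exists L, is_RInt_line h L /\
  (forall N, 1 <= N -> Rabs (L - RInt h (- N) N) <= 2 * C / N) /\ Rabs L <= 4 * C.
Proof.
  set (I2 := fun ab : R * R => RInt h (fst ab) (snd ab)).
  assert (Cauchy : exists L, filterlim I2 (filter_prod (Rbar_locally m_infty) (Rbar_locally p_infty)) (locally L)).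
  { apply filterlim_locally_cauchy. intros eps.
    set (M := 1 + 4 * C / eps).
    assert (HM : 1 <= M).
    { unfold M. assert (0 <= 4 * C / eps) by (apply Rdiv_le_0_compat; [lra | apply cond_pos]). lra. }
    exists (fun ab : R * R => fst ab < - M /\ M < snd ab). split.
    - apply (Filter_prod _ _ _ (fun a => a < - M) (fun b => M < b)); [now exists (- M) | now exists M | auto].
    - intros [a b] [a' b'] [Ha Hb] [Ha' Hb']. simpl in *. apply ball_R_iff.
      pose proof (RInt_window_close M a b HM ltac:(lra) ltac:(lra)).
      pose proof (RInt_window_close M a' b' HM ltac:(lra) ltac:(lra)).
      assert (2 * C / M * 2 < eps).
      { assert (0 < eps) by apply cond_pos.
        apply (Rmult_lt_reg_r M); [lra|]. replace (2 * C / M * 2 * M) with (4 * C) by (field; lra).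
        assert (eps * M = eps + 4 * C) by (unfold M; field; lra). lra. }
      unfold I2. simpl.
      replace (RInt h a' b' - RInt h a b) with
        ((RInt h a' b' - RInt h (- M) M) - (RInt h a b - RInt h (- M) M)) by ring.
      eapply Rle_lt_trans; [apply Rabs_triang | rewrite Rabs_Ropp; lra]. }
  destruct Cauchy as [L HL].
  assert (Hwin : forall N, 1 <= N -> Rabs (L - RInt h (- N) N) <= 2 * C / N).
  { intros N HN. apply (filterlim_Rabs_le _ I2 L _ _ HL).
    apply (Filter_prod _ _ _ (fun a => a < - N) (fun b => N < b)); [now exists (- N) | now exists N |].
    intros a b Ha Hb. unfold I2; simpl. apply RInt_window_close; lra. }
  exists L. split; [|split; [exact Hwin|]].
  - apply (filterlimi_lim_ext I2); [intros [a b]; apply RInt_correct_R, h_ex | exact HL].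
  - assert (Habs : Rabs (RInt h (Ropp 1) 1) <= (1 - Ropp 1) * C).
    { apply abs_RInt_le_const; [lra | apply h_ex |]. intros x _.
      eapply Rle_trans; [apply h_bound|]. unfold Rdiv.
      rewrite <- (Rmult_1_r C) at 2. apply Rmult_le_compat_l; auto.
      rewrite <- Rinv_1. apply Rinv_le_contravar; [lra | simpl; nra]. }
    pose proof (Hwin 1 (Rle_refl 1)) as H1. unfold Rdiv in H1. rewrite Rinv_1 in H1.
    replace L with ((L - RInt h (Ropp 1) 1) + RInt h (Ropp 1) 1) by ring.
    eapply Rle_trans; [apply Rabs_triang | lra].
Qed.

End QuadraticDecay.

Lemma continuous_of_uniform_approx (f : R -> R) (fN : R -> R -> R) D x0 :
  (forall N, 1 <= N -> continuous (fN N) x0) ->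
  (forall N x, 1 <= N -> Rabs (f x - fN N x) <= D / N) -> continuous f x0.
Proof.
  intros Hcont Happrox. apply filterlim_locally. intros eps.
  assert (He : 0 < eps) by apply cond_pos.
  assert (HD : 0 <= D).
  { specialize (Happrox 1 x0 (Rle_refl 1)). unfold Rdiv in Happrox. rewrite Rinv_1 in Happrox.
    pose proof (Rabs_pos (f x0 - fN 1 x0)). lra. }
  set (N := 1 + 3 * D / eps).
  assert (HN : 1 <= N) by (unfold N; assert (0 <= 3 * D / eps) by (apply Rdiv_le_0_compat; lra); lra).
  assert (HDN : D / N < eps / 3).
  { apply (Rmult_lt_reg_r N); [lra|]. replace (D / N * N) with D by (field; lra).
    assert (eps * N = eps + 3 * D) by (unfold N; field; lra). lra. }
  assert (He3 : 0 < eps / 3) by lra.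
  destruct (proj1 (filterlim_locally _ _) (Hcont N HN) (mkposreal _ He3)) as [d Hd].
  exists d. intros x Hx. apply ball_R_iff.
  specialize (Hd x Hx). apply ball_R_iff in Hd. change (Rabs (fN N x - fN N x0) < eps / 3) in Hd.
  pose proof (Happrox N x HN). pose proof (Happrox N x0 HN).
  replace (f x - f x0) with ((f x - fN N x) + (fN N x - fN N x0) - (f x0 - fN N x0)) by ring.
  eapply Rle_lt_trans; [apply Rabs_triang|]. rewrite Rabs_Ropp.
  eapply Rle_lt_trans; [apply Rplus_le_compat_r, Rabs_triang | lra].
Qed.

Lemma decay_lim_infty (f : R -> R) C : 0 <= C -> (forall x, Rabs (f x) <= C / (1 + x ^ 2)) ->
  filterlim f (Rbar_locally m_infty) (locally 0) /\ filterlim f (Rbar_locally p_infty) (locally 0).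
Proof.
  intros C_nonneg Hf.
  assert (K : forall eps x, 0 < eps -> C / eps < Rabs x -> Rabs (f x - 0) < eps).
  { intros eps x He Hx. rewrite Rminus_0_r. eapply Rle_lt_trans; [apply Hf|].
    assert (C < eps * Rabs x).
    { apply (Rmult_lt_compat_l eps) in Hx; auto.
      replace (eps * (C / eps)) with C in Hx by (field; lra). lra. }
    assert (Rabs x <= 1 + x ^ 2).
    { destruct (Rle_or_lt 0 x); [rewrite Rabs_pos_eq | rewrite Rabs_left]; simpl; nra. }
    apply (Rmult_lt_reg_r (1 + x ^ 2)); [simpl; nra|].
    replace (C / (1 + x ^ 2) * (1 + x ^ 2)) with C by (field; simpl; nra). nra. }
  split; apply filterlim_locally; intros eps; assert (He : 0 < eps) by apply cond_pos;
    assert (0 <= C / eps) by (apply Rdiv_le_0_compat; lra).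
  - exists (- (C / eps) - 1). intros x Hx. apply ball_R_iff, K; auto.
    rewrite Rabs_left by lra. lra.
  - exists (C / eps + 1). intros x Hx. apply ball_R_iff, K; auto.
    rewrite Rabs_pos_eq by lra. lra.
Qed.

Lemma is_RInt_line_derive_decay (F dF : R -> R) C :
  (forall p, is_derive F p (dF p)) -> (forall p, continuous dF p) ->
  0 <= C -> (forall p, Rabs (F p) <= C / (1 + p ^ 2)) -> is_RInt_line dF 0.
Proof.
  intros HdF Hcont C_nonneg HF. destruct (decay_lim_infty F C C_nonneg HF) as [Lm Lp].
  assert (EdF : dF = Derive F).
  { apply functional_extensionality. intros p. symmetry. apply is_derive_unique, HdF. }
  rewrite EdF in *. replace 0 with (0 - 0) by ring.
  apply (is_RInt_gen_Derive F 0 0); auto; apply filter_forall; [|auto].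
  intros p. eexists. apply HdF.
Qed.

Definition continuous_2d (g : R -> R -> R) : Prop := forall q p, continuity_2d_pt g q p.

Definition quad_decay_2d (g : R -> R -> R) : Prop :=
  exists C, 0 <= C /\ forall q p, Rabs (g q p) <= C / ((1 + q ^ 2) * (1 + p ^ 2)).

Definition inner_RInt (g : R -> R -> R) (q : R) : R := RInt_line (fun p => g q p).

Lemma continuous_2d_slice g q p : continuous_2d g -> continuous (g q) p.
Proof.
  intros Hg. apply filterlim_locally. intros eps.
  destruct (Hg q p eps) as [d Hd]. exists d. intros y Hy.
  apply ball_R_iff, Hd; [rewrite Rminus_diag_eq, Rabs_R0 by reflexivity; apply cond_pos | exact Hy].
Qed.

Lemma ex_RInt_continuous_2d g q a b : continuous_2d g -> ex_RInt (g q) a b.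
Proof. intros Hg. apply ex_RInt_continuous_R. intros; now apply continuous_2d_slice. Qed.

Lemma continuous_RInt_param g c d q0 : c <= d -> continuous_2d g ->
  continuous (fun q => RInt (g q) c d) q0.
Proof.
  intros Hcd Hg. apply filterlim_locally. intros eps.
  set (eta := eps / (2 * (d - c + 1))).
  assert (Heta : 0 < eta) by (apply Rdiv_lt_0_compat; [apply cond_pos | lra]).
  destruct (uniform_continuity_2d g (q0 - 1) (q0 + 1) c d (fun x y _ _ => Hg x y) (mkposreal _ Heta))
    as [del Hdel].
  assert (Hm : 0 < Rmin del 1) by (apply Rmin_pos; [apply cond_pos | lra]).
  exists (mkposreal _ Hm). intros q Hq. apply ball_R_iff.
  change (Rabs (q - q0) < Rmin del 1) in Hq.
  pose proof (Rmin_r del 1). pose proof (Rmin_l del 1).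
  rewrite <- RInt_minus_R by now apply ex_RInt_continuous_2d.
  eapply Rle_lt_trans.
  - apply (abs_RInt_le_const _ c d eta); auto.
    + apply ex_RInt_continuous_R. intros x.
      apply (continuous_minus (g q) (g q0)); now apply continuous_2d_slice.
    + intros p Hp. left.
      assert (q0 - 1 <= q <= q0 + 1) by (apply Rabs_lt_between' in Hq; lra).
      apply (Hdel q0 p q p); try lra.
      rewrite Rminus_diag_eq, Rabs_R0 by reflexivity. apply cond_pos.
  - assert (0 < eps) by apply cond_pos. unfold eta.
    apply (Rmult_lt_reg_r (2 * (d - c + 1))); [lra|].
    replace ((d - c) * (eps / (2 * (d - c + 1))) * (2 * (d - c + 1))) with ((d - c) * eps)
      by (field; lra).
    nra.
Qed.

Section InnerIntegral.
Variables (g : R -> R -> R) (C : R).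
Hypothesis g_cont : continuous_2d g.
Hypothesis C_nonneg : 0 <= C.
Hypothesis g_bound : forall q p, Rabs (g q p) <= C / ((1 + q ^ 2) * (1 + p ^ 2)).

Lemma inner_RInt_spec q :
  is_RInt_line (fun p => g q p) (inner_RInt g q) /\
  (forall N, 1 <= N -> Rabs (inner_RInt g q - RInt (g q) (- N) N) <= 2 * C / N) /\
  Rabs (inner_RInt g q) <= 4 * C / (1 + q ^ 2).
Proof.
  set (Cq := C / (1 + q ^ 2)).
  assert (Hq : 1 <= 1 + q ^ 2) by (simpl; nra).
  assert (Cq_nonneg : 0 <= Cq) by (unfold Cq; apply Rdiv_le_0_compat; lra).
  assert (Cq_le : Cq <= C).
  { unfold Cq, Rdiv. rewrite <- (Rmult_1_r C) at 2. apply Rmult_le_compat_l; auto.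
    rewrite <- Rinv_1. apply Rinv_le_contravar; lra. }
  assert (Hbound : forall p, Rabs (g q p) <= Cq / (1 + p ^ 2)).
  { intros p. replace (Cq / (1 + p ^ 2)) with (C / ((1 + q ^ 2) * (1 + p ^ 2))) by
      (unfold Cq; field; split; simpl; nra).
    apply g_bound. }
  destruct (is_RInt_line_decay (g q) Cq (fun p => continuous_2d_slice g q p g_cont)
              Cq_nonneg Hbound) as [L [HL [Hwin Habs]]].
  replace (inner_RInt g q) with L by (symmetry; exact (RInt_line_unique _ _ HL)).
  split; [exact HL | split].
  - intros N HN. eapply Rle_trans; [now apply Hwin|].
    unfold Rdiv. apply Rmult_le_compat_r; [left; apply Rinv_0_lt_compat|]; lra.
  - replace (4 * C / (1 + q ^ 2)) with (4 * Cq) by (unfold Cq; field; lra). exact Habs.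
Qed.

Lemma continuous_inner_RInt q0 : continuous (inner_RInt g) q0.
Proof.
  apply (continuous_of_uniform_approx _ (fun N q => RInt (g q) (- N) N) (2 * C)).
  - intros N HN. apply continuous_RInt_param; [lra | exact g_cont].
  - intros N q HN. apply (inner_RInt_spec q), HN.
Qed.

Lemma is_RInt_line_inner_RInt : is_RInt_line (inner_RInt g) (Int2 g).
Proof.
  destruct (is_RInt_line_decay (inner_RInt g) (4 * C) continuous_inner_RInt ltac:(lra)
              (fun q => proj2 (proj2 (inner_RInt_spec q)))) as [L [HL _]].
  unfold Int2. fold (inner_RInt g). now rewrite (RInt_line_unique _ _ HL).
Qed.

End InnerIntegral.

Section QDerivative.
Variables (G dG : R -> R -> R) (C C' : R).
Hypothesis G_derive : forall q p, is_derive (fun x => G x p) q (dG q p).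
Hypothesis G_cont : continuous_2d G.
Hypothesis C_nonneg : 0 <= C.
Hypothesis G_bound : forall q p, Rabs (G q p) <= C / ((1 + q ^ 2) * (1 + p ^ 2)).
Hypothesis dG_cont : continuous_2d dG.
Hypothesis C'_nonneg : 0 <= C'.
Hypothesis dG_bound : forall q p, Rabs (dG q p) <= C' / ((1 + q ^ 2) * (1 + p ^ 2)).

Lemma RInt_RInt_window_dq N a b : 0 <= N ->
  RInt (fun q => RInt (dG q) (- N) N) a b = RInt (G b) (- N) N - RInt (G a) (- N) N.
Proof.
  intros HN.
  assert (EdG : (fun u v => Derive (fun z => G z v) u) = dG).
  { do 2 (apply functional_extensionality; intro). apply is_derive_unique, G_derive. }
  apply is_RInt_unique, (is_RInt_derive (fun q => RInt (G q) (- N) N)).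
  - intros q _.
    replace (RInt (dG q) (- N) N) with (RInt (fun t => Derive (fun u => G u t) q) (- N) N)
      by (apply RInt_ext; intros t _; apply is_derive_unique, G_derive).
    apply (is_derive_RInt_param G (- N) N q).
    + apply filter_forall. intros y t _. eexists. apply G_derive.
    + intros t _. rewrite EdG. apply dG_cont.
    + apply filter_forall. intros y. now apply ex_RInt_continuous_2d.
  - intros q _. apply continuous_RInt_param; [lra | exact dG_cont].
Qed.

(* Compare with the truncations to [-N, N], which obey Leibniz's rule, and let [N] grow. *)
Lemma RInt_inner_RInt_dq a b : RInt (inner_RInt dG) a b = inner_RInt G b - inner_RInt G a.
Proof.
  apply Rminus_diag_uniq, (eq0_of_le_inv _ (Rabs (b - a) * (2 * C') + 4 * C)). intros N HN.
  set (J := fun q => RInt (G q) (- N) N).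
  set (K := fun q => RInt (dG q) (- N) N).
  assert (K_cont : forall q, continuous K q) by (intros; apply continuous_RInt_param; [lra | exact dG_cont]).
  assert (HK : RInt K a b = J b - J a) by (apply RInt_RInt_window_dq; lra).
  assert (IdG_cont : forall x, continuous (inner_RInt dG) x)
    by (intros x; exact (continuous_inner_RInt dG C' dG_cont C'_nonneg dG_bound x)).
  assert (Happrox : Rabs (RInt (inner_RInt dG) a b - RInt K a b) <= Rabs (b - a) * (2 * C' / N)).
  { rewrite <- RInt_minus_R by (apply ex_RInt_continuous_R; assumption).
    apply (norm_RInt_le_const_abs (fun x => inner_RInt dG x - K x) a b).
    - intros x _. exact (proj1 (proj2 (inner_RInt_spec dG C' dG_cont C'_nonneg dG_bound x)) N HN).
    - apply RInt_correct_R, ex_RInt_continuous_R. intros x.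
      apply (continuous_minus (inner_RInt dG) K); auto. }
  destruct (inner_RInt_spec G C G_cont C_nonneg G_bound a) as [_ [Ja _]].
  destruct (inner_RInt_spec G C G_cont C_nonneg G_bound b) as [_ [Jb _]].
  specialize (Ja N HN). specialize (Jb N HN). fold (J a) in Ja. fold (J b) in Jb.
  rewrite HK in Happrox.
  replace (RInt (inner_RInt dG) a b - (inner_RInt G b - inner_RInt G a)) with
    ((RInt (inner_RInt dG) a b - (J b - J a)) - (inner_RInt G b - J b) + (inner_RInt G a - J a))
    by ring.
  replace ((Rabs (b - a) * (2 * C') + 4 * C) / N) with
    (Rabs (b - a) * (2 * C' / N) + 2 * C / N + 2 * C / N) by (field; lra).
  eapply Rle_trans; [apply Rabs_triang|].
  eapply Rle_trans; [apply Rplus_le_compat_r, Rabs_triang|].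
  rewrite Rabs_Ropp. lra.
Qed.

Lemma is_derive_inner_RInt q : is_derive (inner_RInt G) q (inner_RInt dG q).
Proof.
  assert (IdG_cont : forall x, continuous (inner_RInt dG) x)
    by (intros x; exact (continuous_inner_RInt dG C' dG_cont C'_nonneg dG_bound x)).
  assert (Hshift : is_derive (fun x => inner_RInt G x - inner_RInt G 0) q (inner_RInt dG q)).
  { apply (is_derive_RInt _ _ 0); [|apply IdG_cont].
    apply filter_forall. intros x. rewrite <- RInt_inner_RInt_dq.
    apply RInt_correct_R, ex_RInt_continuous_R, IdG_cont. }
  apply (is_derive_ext (fun x => (inner_RInt G x - inner_RInt G 0) + inner_RInt G 0)); [intros t; simpl; ring|].
  rewrite <- (plus_zero_r (inner_RInt dG q)).
  apply (is_derive_plus _ (fun _ => inner_RInt G 0)); [exact Hshift | apply (@is_derive_const R_AbsRing R_NormedModule)].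
Qed.

Lemma is_RInt_line_inner_RInt_dq : is_RInt_line (inner_RInt dG) 0.
Proof.
  apply (is_RInt_line_derive_decay (inner_RInt G) (inner_RInt dG) (4 * C)).
  - exact is_derive_inner_RInt.
  - intros q. exact (continuous_inner_RInt dG C' dG_cont C'_nonneg dG_bound q).
  - lra.
  - intros q. exact (proj2 (proj2 (inner_RInt_spec G C G_cont C_nonneg G_bound q))).
Qed.

End QDerivative.

Lemma Int2_divergence (Rg F G dF dG : R -> R -> R) :
  continuous_2d Rg -> quad_decay_2d Rg ->
  (forall q p, is_derive (fun x => F q x) p (dF q p)) -> continuous_2d dF -> quad_decay_2d F ->
  (forall q p, is_derive (fun x => G x p) q (dG q p)) -> continuous_2d G -> quad_decay_2d G ->
  continuous_2d dG -> quad_decay_2d dG ->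
  Int2 (fun q p => Rg q p + dF q p + dG q p) = Int2 Rg.
Proof.
  intros R_cont [CR [CR_nonneg R_bound]] F_derive dF_cont [CF [CF_nonneg F_bound]]
    G_derive G_cont [CG [CG_nonneg G_bound]] dG_cont [CdG [CdG_nonneg dG_bound]].
  assert (Hinner : forall q, RInt_line (fun p => Rg q p + dF q p + dG q p) =
                             inner_RInt Rg q + inner_RInt dG q).
  { intros q. apply RInt_line_unique. rewrite <- (Rplus_0_r (inner_RInt Rg q)) at 1.
    apply is_RInt_line_plus; [apply is_RInt_line_plus|].
    - exact (proj1 (inner_RInt_spec Rg CR R_cont CR_nonneg R_bound q)).
    - apply (is_RInt_line_derive_decay (F q) (dF q) (CF / (1 + q ^ 2))).
      + apply F_derive.
      + intros p. now apply continuous_2d_slice.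
      + apply Rdiv_le_0_compat; [lra | simpl; nra].
      + intros p. replace (CF / (1 + q ^ 2) / (1 + p ^ 2)) with (CF / ((1 + q ^ 2) * (1 + p ^ 2)))
          by (field; split; simpl; nra).
        apply F_bound.
    - exact (proj1 (inner_RInt_spec dG CdG dG_cont CdG_nonneg dG_bound q)). }
  unfold Int2 at 1. rewrite (functional_extensionality _ _ Hinner).
  apply RInt_line_unique. rewrite <- (Rplus_0_r (Int2 Rg)).
  apply is_RInt_line_plus.
  - apply (is_RInt_line_inner_RInt Rg CR); auto.
  - apply (is_RInt_line_inner_RInt_dq G dG CG CdG); auto.
Qed.

(** * The energy identity *)

Section EnergyFlux.
Variables (hbar : R) (H : R -> R -> R) (a b : R -> R -> R -> R).
Hypothesis H_smooth : smooth2 H.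
Hypothesis a_smooth : smooth3 a.
Hypothesis b_smooth : smooth3 b.

Let h := liftH H.

Definition energy_density (q p t : R) : R :=
  hbar * (mul3 (pd3 Dq h) b (pd3 Dp a) q p t - mul3 (pd3 Dp h) b (pd3 Dq a) q p t
          - mul3 (pd3 Dq h) a (pd3 Dp b) q p t + mul3 (pd3 Dp h) a (pd3 Dq b) q p t)
  - p * (mul3 (pd3 Dp h) a a q p t + mul3 (pd3 Dp h) b b q p t)
  + (mul3 h a a q p t + mul3 h b b q p t).

Definition energy_flux_p (q p t : R) : R :=
  p * (mul3 h a a q p t + mul3 h b b q p t)
  - hbar * (mul3 h a (pd3 Dq b) q p t - mul3 h b (pd3 Dq a) q p t).

Definition energy_flux_q (q p t : R) : R :=
  hbar * (mul3 h a (pd3 Dp b) q p t - mul3 h b (pd3 Dp a) q p t).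

Lemma rho_re_energy_divergence q p t :
  rho_re hbar a b q p t * H q p =
  energy_density q p t + pd3 Dp energy_flux_p q p t + pd3 Dq energy_flux_q q p t.
Proof.
  pd3_eval energy_flux_p. pd3_eval energy_flux_q.
  rewrite (pd3_comm a a_smooth Dp Dq), (pd3_comm b b_smooth Dp Dq).
  unfold rho_re, energy_density, pb3, mul3, h, liftH. ring.
Qed.

Lemma pd3_Dq_energy_flux_q q p t :
  pd3 Dq energy_flux_q q p t =
  hbar * (mul3 (pd3 Dq h) a (pd3 Dp b) q p t + mul3 h (pd3 Dq a) (pd3 Dp b) q p t
          + mul3 h a (pd3 Dq (pd3 Dp b)) q p t - mul3 (pd3 Dq h) b (pd3 Dp a) q p t
          - mul3 h (pd3 Dq b) (pd3 Dp a) q p t - mul3 h b (pd3 Dq (pd3 Dp a)) q p t).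
Proof. pd3_eval energy_flux_q. unfold mul3. ring. Qed.

End EnergyFlux.

Definition is_pd3s_of (f g : R -> R -> R -> R) : Prop := exists ds, g = pd3s ds f.

Lemma is_pd3s_of_refl f : is_pd3s_of f f.
Proof. now exists nil. Qed.

Lemma is_pd3s_of_pd3 f g d : is_pd3s_of f g -> is_pd3s_of f (pd3 d g).
Proof. intros [ds ->]. now exists (d :: ds). Qed.

Definition chi_deriv (chi : R -> R -> R -> C) (g : R -> R -> R -> R) : Prop :=
  is_pd3s_of (reF chi) g \/ is_pd3s_of (imF chi) g.

(* Absorbs the weight [1 + |p|] and the decay profile into the weight of [rapid_decay]. *)
Lemma weight_ineq q p :
  (1 + Rabs p) * ((1 + q ^ 2) * (1 + p ^ 2)) <= 2 * (1 + q ^ 2 + p ^ 2) ^ 3.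
Proof.
  set (s := 1 + q ^ 2 + p ^ 2).
  assert (Hp : Rabs p <= s).
  { unfold s. pose proof (Rabs_pos p). pose proof (pow2_ge_0 q).
    assert (Rabs p * Rabs p = p ^ 2) by (rewrite <- Rabs_mult, Rabs_pos_eq; simpl; nra). nra. }
  assert (Hqp : (1 + q ^ 2) * (1 + p ^ 2) <= s ^ 2) by (unfold s; simpl; nra).
  assert (0 <= (1 + q ^ 2) * (1 + p ^ 2)) by (simpl; nra).
  assert (1 <= s) by (unfold s; simpl; nra).
  replace (s ^ 3) with (s * s ^ 2) by ring. nra.
Qed.

Lemma quad_decay_2d_ext f g : (forall q p, f q p = g q p) -> quad_decay_2d f -> quad_decay_2d g.
Proof. intros E [C [C_nonneg HC]]. exists C. split; [exact C_nonneg|]. intros q p. rewrite <- E. apply HC. Qed.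

Lemma quad_decay_2d_plus f g : quad_decay_2d f -> quad_decay_2d g ->
  quad_decay_2d (fun q p => f q p + g q p).
Proof.
  intros [Cf [Cf_nonneg Hf]] [Cg [Cg_nonneg Hg]]. exists (Cf + Cg). split; [lra|]. intros q p.
  eapply Rle_trans; [apply Rabs_triang|]. specialize (Hf q p). specialize (Hg q p).
  unfold Rdiv in *. rewrite Rmult_plus_distr_r. lra.
Qed.

Lemma quad_decay_2d_scal c f : quad_decay_2d f -> quad_decay_2d (fun q p => c * f q p).
Proof.
  intros [Cf [Cf_nonneg Hf]]. exists (Rabs c * Cf). split; [apply Rmult_le_pos; auto; apply Rabs_pos|].
  intros q p. rewrite Rabs_mult. unfold Rdiv in *. rewrite Rmult_assoc.
  apply Rmult_le_compat_l; [apply Rabs_pos | apply Hf].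
Qed.

Lemma quad_decay_2d_minus f g : quad_decay_2d f -> quad_decay_2d g ->
  quad_decay_2d (fun q p => f q p - g q p).
Proof.
  intros Hf Hg. apply (quad_decay_2d_plus f (fun q p => -1 * g q p)) in Hf;
    [|now apply quad_decay_2d_scal].
  destruct Hf as [C [C_nonneg HC]]. exists C. split; [exact C_nonneg|].
  intros q p. replace (f q p - g q p) with (f q p + -1 * g q p) by ring. apply HC.
Qed.

Lemma quad_decay_2d_weight_plus f g : quad_decay_2d (fun q p => p * f q p) ->
  quad_decay_2d (fun q p => p * g q p) -> quad_decay_2d (fun q p => p * (f q p + g q p)).
Proof.
  intros Hf Hg. destruct (quad_decay_2d_plus _ _ Hf Hg) as [C [C_nonneg HC]].
  exists C. split; [exact C_nonneg|]. intros q p. rewrite Rmult_plus_distr_l. apply HC.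
Qed.

Section RapidDecay.
Variables (H : R -> R -> R) (chi : R -> R -> R -> C) (t : R).
Hypothesis chi_rapid : rapid_decay H chi.

Lemma rapid_decay_bound h f n : is_pd3s_of (liftH H) h -> chi_deriv chi f ->
  exists M, forall q p,
    (1 + q ^ 2 + p ^ 2) ^ n * (1 + Rabs (h q p t)) * Rabs (f q p t) <= M.
Proof.
  intros [dsH ->] Hf.
  assert (Hds : exists ds, forall q p,
    Rabs (f q p t) <= Rabs (pd3s ds (reF chi) q p t) + Rabs (pd3s ds (imF chi) q p t)).
  { destruct Hf as [[ds ->] | [ds ->]]; exists ds; intros q p;
      pose proof (Rabs_pos (pd3s ds (reF chi) q p t));
      pose proof (Rabs_pos (pd3s ds (imF chi) q p t)); lra. }
  destruct Hds as [ds Hds]. destruct (chi_rapid t ds dsH n) as [M HM].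
  exists M. intros q p. eapply Rle_trans; [|apply HM].
  apply Rmult_le_compat_l; [|apply Hds].
  apply Rmult_le_pos; [apply pow_le; simpl; nra | pose proof (Rabs_pos (pd3s dsH (liftH H) q p t)); lra].
Qed.

Lemma chi_deriv_bounded g : chi_deriv chi g -> exists M, 0 <= M /\ forall q p, Rabs (g q p t) <= M.
Proof.
  intros Hg. destruct (rapid_decay_bound (liftH H) g 0 (is_pd3s_of_refl _) Hg) as [M HM].
  assert (Hbound : forall q p, Rabs (g q p t) <= M).
  { intros q p. eapply Rle_trans; [|apply (HM q p)]. simpl.
    pose proof (Rabs_pos (liftH H q p t)). pose proof (Rabs_pos (g q p t)). nra. }
  exists M. split; [eapply Rle_trans; [apply Rabs_pos | apply (Hbound 0 0)] | exact Hbound].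
Qed.

Lemma quad_decay_mul3 (w : R -> R) h f g :
  (forall p, Rabs (w p) <= 1 + Rabs p) -> is_pd3s_of (liftH H) h -> chi_deriv chi f -> chi_deriv chi g ->
  quad_decay_2d (fun q p => w p * mul3 h f g q p t).
Proof.
  intros Hw Hh Hf Hg.
  destruct (rapid_decay_bound h f 3 Hh Hf) as [M1 HM1].
  destruct (chi_deriv_bounded g Hg) as [M2 [M2_nonneg Hg_bound]].
  assert (M1_nonneg : 0 <= M1).
  { eapply Rle_trans; [|apply (HM1 0 0)].
    pose proof (Rabs_pos (h 0 0 t)). pose proof (Rabs_pos (f 0 0 t)).
    apply Rmult_le_pos; [apply Rmult_le_pos; [apply pow_le; simpl|]|]; lra. }
  exists (2 * M1 * M2). split; [nra|]. intros q p.
  set (s := 1 + q ^ 2 + p ^ 2) in HM1.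
  set (X := (1 + Rabs (h q p t)) * Rabs (f q p t)).
  assert (HX : s ^ 3 * X <= M1) by (unfold X; rewrite <- Rmult_assoc; apply HM1).
  assert (X_nonneg : 0 <= X) by (unfold X; pose proof (Rabs_pos (h q p t)); pose proof (Rabs_pos (f q p t)); nra).
  assert (Hhf : Rabs (h q p t) * Rabs (f q p t) <= X).
  { unfold X. apply Rmult_le_compat_r; [apply Rabs_pos | lra]. }
  assert (Hprod : Rabs (w p * mul3 h f g q p t) <= (1 + Rabs p) * (X * M2)).
  { unfold mul3. rewrite !Rabs_mult.
    apply Rmult_le_compat; [apply Rabs_pos | | apply Hw | apply Rmult_le_compat].
    - repeat apply Rmult_le_pos; apply Rabs_pos.
    - apply Rmult_le_pos; apply Rabs_pos.
    - apply Rabs_pos.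
    - exact Hhf.
    - apply Hg_bound. }
  pose proof (weight_ineq q p) as Hweight. fold s in Hweight.
  assert (Q_pos : 0 < (1 + q ^ 2) * (1 + p ^ 2)) by (simpl; nra).
  apply (Rmult_le_reg_r ((1 + q ^ 2) * (1 + p ^ 2))); [exact Q_pos|].
  replace (2 * M1 * M2 / ((1 + q ^ 2) * (1 + p ^ 2)) * ((1 + q ^ 2) * (1 + p ^ 2)))
    with (2 * M1 * M2) by (field; split; simpl; nra).
  eapply Rle_trans; [apply Rmult_le_compat_r; [lra | exact Hprod]|].
  pose proof (Rabs_pos p).
  replace ((1 + Rabs p) * (X * M2) * ((1 + q ^ 2) * (1 + p ^ 2)))
    with ((1 + Rabs p) * ((1 + q ^ 2) * (1 + p ^ 2)) * (X * M2)) by ring.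
  eapply Rle_trans; [apply Rmult_le_compat_r; [nra | exact Hweight]|].
  nra.
Qed.

Lemma quad_decay_mul3_weight h f g : is_pd3s_of (liftH H) h -> chi_deriv chi f -> chi_deriv chi g ->
  quad_decay_2d (fun q p => p * mul3 h f g q p t).
Proof. apply (quad_decay_mul3 (fun p => p)). intros p. lra. Qed.

Lemma quad_decay_mul3_unit h f g : is_pd3s_of (liftH H) h -> chi_deriv chi f -> chi_deriv chi g ->
  quad_decay_2d (fun q p => mul3 h f g q p t).
Proof.
  intros Hh Hf Hg. destruct (quad_decay_mul3 (fun _ => 1) h f g) as [C [C_nonneg HC]]; auto.
  - intros p. rewrite Rabs_R1. pose proof (Rabs_pos p). lra.
  - exists C. split; [exact C_nonneg|]. intros q p. rewrite <- (Rmult_1_l (mul3 h f g q p t)). apply HC.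
Qed.

End RapidDecay.

Ltac is_pd3s_of_tac := repeat apply is_pd3s_of_pd3; apply is_pd3s_of_refl.

Ltac chi_deriv_tac := first [left; is_pd3s_of_tac | right; is_pd3s_of_tac].

Ltac quad_decay_tac chi_rapid :=
  repeat first
    [ apply quad_decay_2d_minus | apply quad_decay_2d_plus | apply quad_decay_2d_weight_plus
    | apply quad_decay_2d_scal
    | apply (quad_decay_mul3_weight _ _ _ chi_rapid); [is_pd3s_of_tac | chi_deriv_tac | chi_deriv_tac]
    | apply (quad_decay_mul3_unit _ _ _ chi_rapid); [is_pd3s_of_tac | chi_deriv_tac | chi_deriv_tac] ].

Lemma continuity_2d_pt_smooth3_slice g q p t : smooth3 g -> continuity_2d_pt (fun u v => g u v t) q p.
Proof. intros Hg. exact (proj1 (continuity_2d_pt_smooth3 g q p t Hg)). Qed.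

Lemma continuous_2d_ext f g : (forall q p, f q p = g q p) -> continuous_2d f -> continuous_2d g.
Proof. intros E Hf q p. apply (continuity_2d_pt_ext f g); auto. Qed.

Ltac continuous_2d_tac :=
  let q := fresh "q" in let p := fresh "p" in
  intros q p; unfold mul3;
  repeat first
    [ apply continuity_2d_pt_plus | apply continuity_2d_pt_minus | apply continuity_2d_pt_mult
    | apply continuity_2d_pt_opp | apply continuity_2d_pt_id1 | apply continuity_2d_pt_id2
    | apply continuity_2d_pt_const
    | apply continuity_2d_pt_smooth3_slice; smooth3_pd3_tac ].

Section EnergyIntegral.
Variables (hbar : R) (H : R -> R -> R) (chi : R -> R -> R -> C) (t : R).
Hypothesis H_smooth : smooth2 H.
Hypothesis re_smooth : smooth3 (reF chi).
Hypothesis im_smooth : smooth3 (imF chi).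
Hypothesis chi_rapid : rapid_decay H chi.

Let a := reF chi.
Let b := imF chi.

Lemma Re_conj_kvh_rhs q p :
  Re (Cconj (chi q p t) * kvh_rhs hbar H chi q p t) = energy_density hbar H a b q p t.
Proof.
  unfold kvh_rhs, PB, dC. rewrite !pd3_zero. change (reF (Hc H)) with (liftH H).
  change (H q p) with (liftH H q p t).
  unfold energy_density, mul3, a, b, reF, imF, Re, Im. destruct (chi q p t) as [x y]. simpl. ring.
Qed.

Lemma is_derive_energy_flux_p q p :
  is_derive (fun x => energy_flux_p hbar H a b q x t) p (pd3 Dp (energy_flux_p hbar H a b) q p t).
Proof. apply Derive_correct. unfold energy_flux_p, mul3. auto_derive. solve_ex_derive. Qed.

Lemma is_derive_energy_flux_q q p :
  is_derive (fun x => energy_flux_q hbar H a b x p t) q (pd3 Dq (energy_flux_q hbar H a b) q p t).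
Proof. apply Derive_correct. unfold energy_flux_q, mul3. auto_derive. solve_ex_derive. Qed.

Lemma continuous_2d_pd3_Dp_energy_flux_p : continuous_2d (fun q p => pd3 Dp (energy_flux_p hbar H a b) q p t).
Proof.
  eapply continuous_2d_ext.
  - intros q p. symmetry. pd3_eval (energy_flux_p hbar H a b). reflexivity.
  - continuous_2d_tac.
Qed.

Lemma Int2_energy :
  Int2 (fun q p => Re (rho_c hbar chi q p t) * H q p) =
  Int2 (fun q p => Re (Cconj (chi q p t) * kvh_rhs hbar H chi q p t)).
Proof.
  assert (Eleft : (fun q p => Re (rho_c hbar chi q p t) * H q p) =
    (fun q p => energy_density hbar H a b q p t + pd3 Dp (energy_flux_p hbar H a b) q p t
                + pd3 Dq (energy_flux_q hbar H a b) q p t)).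
  { do 2 (apply functional_extensionality; intro).
    rewrite Re_rho_c by assumption. now apply rho_re_energy_divergence. }
  assert (Eright : (fun q p => Re (Cconj (chi q p t) * kvh_rhs hbar H chi q p t)) =
                   (fun q p => energy_density hbar H a b q p t)).
  { do 2 (apply functional_extensionality; intro). apply Re_conj_kvh_rhs. }
  rewrite Eleft, Eright.
  apply (Int2_divergence _ (fun q p => energy_flux_p hbar H a b q p t)
                           (fun q p => energy_flux_q hbar H a b q p t)).
  - unfold energy_density. continuous_2d_tac.
  - unfold energy_density. quad_decay_tac chi_rapid.
  - exact is_derive_energy_flux_p.
  - exact continuous_2d_pd3_Dp_energy_flux_p.
  - unfold energy_flux_p. quad_decay_tac chi_rapid.
  - exact is_derive_energy_flux_q.
  - unfold energy_flux_q. continuous_2d_tac.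
  - unfold energy_flux_q. quad_decay_tac chi_rapid.
  - eapply continuous_2d_ext; [intros q p; symmetry; apply pd3_Dq_energy_flux_q; assumption|].
    continuous_2d_tac.
  - eapply quad_decay_2d_ext; [intros q p; symmetry; apply pd3_Dq_energy_flux_q; assumption|].
    quad_decay_tac chi_rapid.
Qed.

End EnergyIntegral.

Theorem mainTheorem2 (hbar : R) (H : R -> R -> R) (chi : R -> R -> R -> C) :
  0 < hbar ->
  smooth2 H ->
  smooth3 (reF chi) -> smooth3 (imF chi) ->
  rapid_decay H chi ->
  KvH hbar H chi ->
  (forall q p t, Im (rho_c hbar chi q p t) = 0) /\
  (forall q p t, dC Dt (rho_c hbar chi) q p t = PB (Hc H) (rho_c hbar chi) q p t) /\
  (forall t,
     Int2 (fun q p => Re (rho_c hbar chi q p t) * H q p) =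
     Int2 (fun q p =>
       Re (Cconj (chi q p t) *
           (Ci * RtoC hbar * PB (Hc H) chi q p t
            - RtoC (p * pd3 Dp (liftH H) q p t - H q p) * chi q p t))%C)).
Proof.
  intros hbar_pos H_smooth re_smooth im_smooth chi_rapid chi_kvh. split; [|split].
  - intros q p t. apply Im_rho_c.
  - intros q p t. now apply rho_c_liouville.
  - intros t. now apply Int2_energy.
Qed.
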